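(* Let $\sigma^2>0$, let $P_X$ be a distribution on $\mathbb{R}^d$, let $\phi^r:\mathbb{R}^d\to\mathbb{R}^r$ be a feature map, let $L\in\mathbb{R}^{r\times r}$ be a fixed matrix and $\phi^L(x):=L^\top\phi^r(x)\in\mathbb{R}^r$. Assume $\|\phi^L(x)\|_2\le K$ for all $x$ (training and test points), and that $\Sigma:=\mathbb{E}_{x\sim P_X}[\phi^L(x)\phi^L(x)^\top]$ satisfies $\lambda_{\min}(\Sigma)>0$. Let $\delta>0$ and let $N\ge k\ge\frac83\log(4r/\delta)\left(\frac{8K^2}{\lambda_{\min}(\Sigma)}\right)^2$. Let $\mathbf{x}_1,\ldots,\mathbf{x}_N\sim P_X$ be i.i.d., and let $s_1,\ldots,s_k\in\{1,\ldots,N\}$ be drawn uniformly without replacement. Define $\hat\Sigma_N:=\frac1N\sum_{i=1}^N\phi^L(\mathbf{x}_i)\phi^L(\mathbf{x}_i)^\top$ and $\hat\Sigma_k:=\frac1k\sum_{i=1}^k\phi^L(\mathbf{x}_{s_i})\phi^L(\mathbf{x}_{s_i})^\top$. For test points $\mathbf{x}'_1,\ldots,\mathbf{x}'_{N'}$ let $\Phi^L_{\mathbf{x}'}\in\mathbb{R}^{N'\times r}$ have rows $\phi^L(\mathbf{x}'_i)^\top$, and define $$S^B_{\mathbf{x}',\mathbf{x}'}:=\Phi^L_{\mathbf{x}'}\Big(\tfrac{1}{\sigma^2}N\hat\Sigma_N+I_r\Big)^{-1}\Phi^{L\top}_{\mathbf{x}'},\qquad S^{B,k}_{\mathbf{x}',\mathbf{x}'}:=\Phi^L_{\mathbf{x}'}\Big(\tfrac{1}{\sigma^2}N\hat\Sigma_k+I_r\Big)^{-1}\Phi^{L\top}_{\mathbf{x}'}.$$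 Then with probability at least $1-\delta$, for any $N'$ and any test points $\mathbf{x}'_1,\ldots,\mathbf{x}'_{N'}$, $$\big\|S^{B,k}_{\mathbf{x}',\mathbf{x}'}-S^B_{\mathbf{x}',\mathbf{x}'}\big\|_2\le N'\,\frac{2K^4}{\lambda_{\min}(\Sigma)}\sqrt{\frac{8\log(4r/\delta)}{3k}}.$$
   Context: $\|\cdot\|_2$ is the spectral norm and $\lambda_{\min}$ the smallest eigenvalue. $S^B$ is the (full-data) predictive covariance with features $\phi^L$ and noise variance $\sigma^2$; $S^{B,k}$ is its subsampled approximation. *)

(* Defs.v *)
From HB Require Import structures.
From mathcomp Require Import all_boot all_order all_algebra.
From mathcomp Require Import all_classical all_reals all_analysis.
Set Implicit Arguments.
Unset Strict Implicit.
Unset Printing Implicit Defensive.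
Import Order.TTheory GRing.Theory Num.Theory.
Local Open Scope classical_set_scope.
Local Open Scope ring_scope.

Section Defs.
Variable R : realType.

Definition norm2 n (v : 'cV[R]_n) : R := Num.sqrt (\sum_(i < n) v i 0 ^+ 2).

Definition spec_norm m n (A : 'M[R]_(m, n)) : R :=
  sup [set norm2 (A *m v) | v in [set v : 'cV[R]_n | norm2 v <= 1]].

(* smallest eigenvalue (of a symmetric matrix: all eigenvalues are real) *)
Definition lambda_min n (A : 'M[R]_n) : R := inf [set a : R | eigenvalue A a].

Definition phiL (X : Type) r (L : 'M[R]_r) (phir : X -> 'cV[R]_r) (x : X)
  : 'cV[R]_r := L^T *m phir x.

Definition Sigma_pop dX (X : measurableType dX) (PX : probability X R) r
  (phi : X -> 'cV[R]_r) : 'M[R]_r :=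
  \matrix_(i, j) Rintegral PX setT (fun x => phi x i 0 * phi x j 0).

Definition Sigma_hatN (X : Type) r (phi : X -> 'cV[R]_r) N (xs : 'I_N -> X)
  : 'M[R]_r := (N%:R)^-1 *: \sum_(i < N) (phi (xs i) *m (phi (xs i))^T).

Definition Sigma_hatk (X : Type) r (phi : X -> 'cV[R]_r) N k (xs : 'I_N -> X)
  (s : 'I_k -> 'I_N) : 'M[R]_r :=
  (k%:R)^-1 *: \sum_(j < k) (phi (xs (s j)) *m (phi (xs (s j)))^T).

Definition Phi_mat (X : Type) r (phi : X -> 'cV[R]_r) N' (xs' : 'I_N' -> X)
  : 'M[R]_(N', r) := \matrix_(i, j) phi (xs' i) j 0.

Definition S_post (X : Type) r (phi : X -> 'cV[R]_r) (sigma2 : R) (N : nat)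
  (Sig : 'M[R]_r) N' (xs' : 'I_N' -> X) : 'M[R]_N' :=
  Phi_mat phi xs' *m invmx ((sigma2^-1 * N%:R) *: Sig + 1%:M) *m (Phi_mat phi xs')^T.

Definition inj_samples N k : {set {ffun 'I_k -> 'I_N}} :=
  [set f : {ffun 'I_k -> 'I_N} | injectiveb f].

(* Sampling model: x_1..x_N i.i.d. with law PX, and (s_1..s_k) uniform over
   ordered samples without replacement, independent of the x_i.  Stated as the
   product rule on measurable rectangles (which determines the joint law as
   PX^N (x) Uniform). *)
Definition iid_subsample_model dO (Omega : measurableType dO) (P : probability Omega R)
  dX (X : measurableType dX) (PX : probability X R) N k
  (x : 'I_N -> Omega -> X) (s : Omega -> {ffun 'I_k -> 'I_N}) : Prop :=
  [/\ (forall i, measurable_fun setT (x i)),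
      (forall B : {set {ffun 'I_k -> 'I_N}}, measurable (s @^-1` [set f | f \in B]))
    & forall (A : 'I_N -> set X) (B : {set {ffun 'I_k -> 'I_N}}),
        (forall i, measurable (A i)) ->
        P [set w | (forall i, A i (x i w)) /\ s w \in B]
        = ((\prod_(i < N) PX (A i)) *
           (#|B :&: inj_samples N k|%:R / #|inj_samples N k|%:R)%:E)%E ].

End Defs.

(* Main.v *)
(* The features enter through rank-one matrices, and |phi phi^T|_F = |phi|^2 <= K^2,
   so no matrix Chernoff bound is needed: a dimension-free Hoeffding inequality
   in the Hilbert space of matrices with the Frobenius norm already beats the
   claimed rate.  It is obtained from the supermartingale exp (l_j |S_j|^2 + c_j),
   where S_j is the j-th partial sum of the centred matrices and the one-step
   bound follows from e^y <= y + e^(y^2).  Conditionally on the subsample s = f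
   the k selected points are i.i.d., hence with t = sqrt (8 log (4r/delta) / (3k))
   and u = (8/3) K^2 t, both empirical covariances are within u <= lambda_min / 3
   of Sigma with probability at least 1 - delta.  On that event, with
   a = N / sigma^2 and z = (2/3) lambda_min, the identity
   A^-1 - B^-1 = A^-1 (B - A) B^-1 bounds the difference of the resolvents by
   2 a u / (1 + a z)^2 <= u / (2 z) = 2 K^2 t / lambda_min. *)
Require Import Defs.
From HB Require Import structures.
From mathcomp Require Import all_boot all_order all_algebra.
From mathcomp Require Import all_classical all_reals all_analysis.
From mathcomp Require Import measurable_realfun ring lra.
Set Implicit Arguments.
Unset Strict Implicit.
Unset Printing Implicit Defensive.
Import Order.TTheory GRing.Theory Num.Theory.
Local Open Scope classical_set_scope.
Local Open Scope ring_scope.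

(** * Pushforward measures and sequential independence of draws *)

(** The measurability proof is an argument so that the measure structure, whose construction depends
    on it, can be inferred from the term itself. *)
Definition law d d' (T : measurableType d) (T' : measurableType d') (R : realType)
    (mu : set T -> \bar R) (f : T -> T') (mf : measurable_fun setT f)
    : set T' -> \bar R :=
  pushforward mu f.

Section law_measure.
Context d d' (T : measurableType d) (T' : measurableType d') (R : realType).
Variables (mu : {measure set T -> \bar R}) (f : T -> T').
Hypothesis mf : measurable_fun setT f.

Let law0 : law mu mf set0 = 0%E. Proof. exact: measure0. Qed.

Let law_ge0 A : (0 <= law mu mf A)%E. Proof. exact: measure_ge0. Qed.

Let law_sigma_additive : semi_sigma_additive (law mu mf).
Proof. exact: measure_semi_sigma_additive. Qed.

HB.instance Definition _ := isMeasure.Build _ _ _ (law mu mf)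
  law0 law_ge0 law_sigma_additive.

End law_measure.

Section law_finite_measure.
Context d d' (T : measurableType d) (T' : measurableType d') (R : realType).
Variables (mu : {finite_measure set T -> \bar R}) (f : T -> T').
Hypothesis mf : measurable_fun setT f.

Let law_finite : fin_num_fun (law mu mf).
Proof.
by apply: lty_fin_num_fun; rewrite /= /law /pushforward preimage_setT fin_num_fun_lty.
Qed.

HB.instance Definition _ := Measure_isFinite.Build _ _ _ (law mu mf) law_finite.

End law_finite_measure.

Section sequential_independence.
Local Open Scope ereal_scope.
Context {R : realType} {dO dX dT : measure_display}.
Context {Omega : measurableType dO} {X : measurableType dX} {T : measurableType dT}.
Variables (nu : {finite_measure set Omega -> \bar R}) (PX : probability X R).

(** [nu] is finite but not normalised, so that the restriction of a probability to an event
    qualifies: independence given that event becomes a product rule without division. Indexing the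
    draws by [nat] makes dropping the first one a mere shift. *)
Definition independent_draws n (Y : Omega -> T) (y : nat -> Omega -> X) : Prop :=
  forall (A : set T) (C : nat -> set X), measurable A ->
    (forall i, measurable (C i)) ->
    nu [set w | A (Y w) /\ forall i, (i < n)%N -> C i (y i w)]
    = nu (Y @^-1` A) * \prod_(i < n) PX (C i).

Lemma measurable_draws n (y : nat -> Omega -> X) (C : nat -> set X) :
  (forall i, measurable_fun setT (y i)) -> (forall i, measurable (C i)) ->
  measurable [set w | forall i, (i < n)%N -> C i (y i w)].
Proof.
move=> my mC; rewrite (_ : [set _ | _] = \bigcap_(i < n) (y i @^-1` C i)).
  apply: bigcap_measurableType => i _.
  by rewrite -[X in measurable X]setTI; exact: my.
by apply/seteqP; split.
Qed.

Lemma fin_num_prod_probability n (C : nat -> set X) :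
  (forall i, measurable (C i)) ->
  \prod_(i < n) PX (C i) = (\prod_(i < n) fine (PX (C i)))%:E.
Proof.
move=> mC; rewrite -prodEFin; apply: eq_bigr => i _.
by rewrite fineK// fin_num_measure.
Qed.

(** With the event on the later draws fixed, both sides are finite measures in the set that
    constrains the pair of [Y] and the first draw. They agree on rectangles, a pi-system that
    generates the product sigma-algebra, hence also on the preimage of [A] under [a]. *)
Lemma independent_draws_step n (Y : Omega -> T) (y : nat -> Omega -> X)
    (a : T * X -> T) :
  measurable_fun setT Y -> (forall i, measurable_fun setT (y i)) ->
  measurable_fun setT a -> independent_draws n.+1 Y y ->
  independent_draws n (fun w => a (Y w, y 0%N w)) (fun i => y i.+1).
Proof.
move=> mY my ma ind A C mA mC.
have mpair : measurable_fun setT (fun w => (Y w, y 0%N w)).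
  exact: measurable_fun_pair.
have mS : measurable [set w | forall i, (i < n)%N -> C i (y i.+1 w)].
  exact: (@measurable_draws n (fun i => y i.+1)).
have c0 : (0 <= \prod_(i < n) fine (PX (C i)))%R.
  by apply: prodr_ge0 => i _; exact: fine_ge0.
pose m1 : {measure set (T * X)%type -> \bar R} := law (mrestr nu mS) mpair.
pose m2 : {measure set (T * X)%type -> \bar R} :=
  mscale (NngNum c0) (law nu mpair).
suff E : forall B, measurable B -> m1 B = m2 B.
  have mB : measurable (a @^-1` A) by rewrite -[X in measurable X]setTI; exact: ma.
  have := E _ mB; rewrite /m1 /m2/= /mscale/= /law/= /pushforward /mrestr/=.
  by rewrite fin_num_prod_probability// muleC => <-; congr (nu _).
pose G : set (set (T * X)) :=
  [set D | exists A, measurable A /\ exists B, measurable B /\ D = A `*` B].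
move=> B; apply: (measure_unique G (fun=> setT)).
- rewrite measurable_prod_measurableType //; congr (<<s _ >>).
  rewrite predeqE; split => [[A' mA' [B' mB' <-]]|[A' [mA' [B' [mB' ->]]]]].
    by exists A'; split => //; exists B'.
  by exists A' => //; exists B'.
- move=> /= _ _ [X1 [mX1 [X2 [mX2 ->]]]] [Y1 [mY1 [Y2 [mY2 ->]]]].
  rewrite -setXI; exists (X1 `&` Y1); split; first exact: measurableI.
  by exists (X2 `&` Y2); split => //; exact: measurableI.
- by move=> _; exists setT; split => //; exists setT; split => //; rewrite setXTT.
- by rewrite bigcup_const//; exists 0%N.
- move=> _ [A' [mA' [B' [mB' ->]]]].
  rewrite /m1 /m2/= /mscale/= /law/= /pushforward /mrestr/=.
  (* The hypothesis is used on two rectangles: [C1] puts [B'] in front of [C], while [C2] lets [B']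
     be followed by the whole space, of mass 1. *)
  pose C1 i := if i is i'.+1 then C i' else B'.
  pose C2 i : set X := if i is i'.+1 then setT else B'.
  have mC1 i : measurable (C1 i) by case: i => /=.
  have mC2 i : measurable (C2 i) by case: i => /=.
  transitivity (nu [set w | A' (Y w) /\ forall i, (i < n.+1)%N -> C1 i (y i w)]).
    congr (nu _); apply/seteqP; split => w /=.
      by move=> [[Aw Bw] Cw]; split=> // -[_|i]; [exact: Bw|exact: Cw].
    by move=> [Aw Cw]; split; [split => //; exact: (Cw 0%N)|move=> i /(Cw i.+1)].
  rewrite ind// [in RHS](_ : _ @^-1` _ =
      [set w | A' (Y w) /\ forall i, (i < n.+1)%N -> C2 i (y i w)]); last first.
    apply/seteqP; split => w /=.
      by move=> [Aw Bw]; split=> // -[_|//]; exact: Bw.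
    by move=> [Aw Cw]; split => //; exact: (Cw 0%N).
  rewrite ind// !big_ord_recl/= [X in _ = _ * (_ * (PX B' * X))]big1 ?mule1; last first.
    by move=> i _; rewrite probability_setT.
  by rewrite fin_num_prod_probability// [RHS]muleC muleA.
- by move=> k; rewrite /m1/= /law/pushforward/mrestr preimage_setT setTI ltey_eq fin_num_measure.
Qed.

(** By the product rule and uniqueness of the product measure, the joint law of [Y] and the first
    draw is the law of [Y] times [PX]; Tonelli does the rest. *)
Lemma independent_draws_integral n (Y : Omega -> T) (y : nat -> Omega -> X)
    (F : T * X -> \bar R) :
  measurable_fun setT Y -> (forall i, measurable_fun setT (y i)) ->
  measurable_fun [set: T * X] F -> (forall z, 0 <= F z) ->
  independent_draws n.+1 Y y ->
  \int[nu]_w F (Y w, y 0%N w) = \int[nu]_w \int[PX]_z F (Y w, z).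
Proof.
move=> mY my mF F0 ind.
have mpair : measurable_fun setT (fun w => (Y w, y 0%N w)).
  exact: measurable_fun_pair.
have mFF := measurable_fun_fubini_tonelli_F (m2 := PX) F mF F0.
transitivity (\int[law nu mpair]_z F z).
  by rewrite ge0_integral_pushforward//= preimage_setT.
transitivity (\int[law nu mY \x PX]_z F z).
  apply: eq_measure_integral => // B mB _; apply/esym.
  apply: (product_measure_unique (m' := law nu mpair)) => //.
  move=> A B' mA mB'.
  pose C2 i : set X := if i is i'.+1 then setT else B'.
  have mC2 i : measurable (C2 i) by case: i => /=.
  transitivity (nu [set w | A (Y w) /\ forall i, (i < n.+1)%N -> C2 i (y i w)]).
    congr (nu _); apply/seteqP; split => w /=.
      by move=> [Aw Bw]; split=> // -[_|//]; exact: Bw.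
    by move=> [Aw Cw]; split => //; exact: (Cw 0%N).
  rewrite ind// !big_ord_recl/= [X in PX B' * X]big1 ?mule1// => i _.
  by rewrite probability_setT.
rewrite fubini_tonelli1//.
rewrite ge0_integral_pushforward//= ?preimage_setT//.
by move=> t _; exact: integral_ge0.
Qed.

(** Induction peels off the first draw: it is absorbed into the state and [V] is shifted by one,
    which leaves the integral of [V 1] after one move. Integrating that draw out and using the
    one-step bound at 0 gives [V 0]. *)
Lemma independent_draws_supermartingale n (a : T * X -> T) (V : nat -> T -> \bar R)
    (Y : Omega -> T) (y : nat -> Omega -> X) :
  measurable_fun setT a -> (forall j, measurable_fun setT (V j)) ->
  (forall j t, 0 <= V j t) ->
  (forall j t, (j < n)%N -> \int[PX]_z V j.+1 (a (t, z)) <= V j t) ->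
  measurable_fun setT Y -> (forall i, measurable_fun setT (y i)) ->
  independent_draws n Y y ->
  \int[nu]_w V n (iteri n (fun j t => a (t, y j w)) (Y w)) <= \int[nu]_w V 0%N (Y w).
Proof.
move=> ma; elim: n V Y y => [|n IH] V Y y mV V0 Vstep mY my ind; first exact: lexx.
have mY1 : measurable_fun setT (fun w => a (Y w, y 0%N w)).
  by apply: (measurableT_comp ma); exact: measurable_fun_pair.
have /= := IH (fun j => V j.+1) _ (fun i => y i.+1) _ _ _ mY1 _
  (independent_draws_step mY my ma ind).
move=> /(_ (fun j => mV j.+1) (fun j => V0 j.+1) (fun j t jn => Vstep j.+1 t jn)).
move=> /(_ (fun i => my i.+1)) H.
have E w : iteri n (fun j t => a (t, y j.+1 w)) (a (Y w, y 0%N w)) =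
    iteri n.+1 (fun j t => a (t, y j w)) (Y w).
  by elim: n {IH Vstep ind H} => //= n ->.
rewrite -(eq_integral _ _ (fun w _ => congr1 (V n.+1) (E w))).
apply: (le_trans H).
pose F z := V 1%N (a z).
have mF : measurable_fun setT F by exact: measurableT_comp.
rewrite (independent_draws_integral (F := F) mY my mF _ ind); last first.
  by move=> z; exact: V0.
have mFF := measurable_fun_fubini_tonelli_F (m2 := PX) F mF (fun z => V0 _ _).
apply: ge0_le_integral => //=.
- by move=> w _; apply: integral_ge0 => z _; exact: V0.
- exact: (measurableT_comp mFF mY).
- exact: (measurableT_comp (mV 0%N) mY).
- by move=> w _; exact: Vstep.
Qed.

End sequential_independence.

(** * Elementary inequalities *)

(** Three ranges. For y <= 0, exp y <= 1 / (1 - y) <= 1 + y + y^2, as (1 - y) (1 + y + y^2) = 1 -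
    y^3. For y > 1, y <= y^2 already suffices. Between 0 and 1 the exponentials are replaced by
    polynomials. *)
Lemma expR_le_add_expR_sqr (R : realType) (y : R) : expR y <= y + expR (y ^+ 2).
Proof.
have [y0|y0] := leP y 0.
  apply: (@le_trans _ _ (y + (1 + y ^+ 2))); last by rewrite lerD2l expR_ge1Dx.
  have := expR_ge1Dx (- y); have := expR_gt0 y.
  have := expRxMexpNx_1 y; set a := expR y; set b := expR (- y) => ab a0 yb.
  have y1 : 0 < 1 - y by lra.
  rewrite -(ler_pM2r y1); apply: (@le_trans _ _ 1); last first.
    rewrite -subr_ge0 (_ : _ - _ = - y * y ^+ 2); last by ring.
    by rewrite mulr_ge0 ?sqr_ge0// oppr_ge0.
  by rewrite -[leRHS]ab ler_wpM2l// ltW.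
have [y1|y1] := leP y 1; last first.
  apply: (@le_trans _ _ (expR (y ^+ 2))); last by rewrite lerDr ltW.
  by rewrite ler_expR expr2 ler_peMl// ltW.
(* [(1 + y^2/2)^2 <= exp (y^2)] and [(1 - y/4)^4 <= exp (- y)] *)
apply: (@le_trans _ _ (y + (1 + y ^+ 2 / 2) ^+ 2)); last first.
  rewrite lerD2l (_ : y ^+ 2 = 2%:R * (y ^+ 2 / 2)); last by field.
  rewrite expRM_natl mulrC mulKf// lerXn2r ?nnegrE ?expR_ge0 ?expR_ge1Dx//.
  by rewrite addr_ge0// divr_ge0// sqr_ge0.
have h4 : (1 - y / 4) ^+ 4 <= expR (- y).
  rewrite (_ : - y = 4%:R * (- y / 4)); last by field.
  rewrite expRM_natl lerXn2r ?nnegrE ?expR_ge0 //; last first.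
    by rewrite mulNr; exact: expR_ge1Dx.
  by rewrite subr_ge0; lra.
have p4 : 0 < (1 - y / 4) ^+ 4 by rewrite exprn_gt0//; lra.
rewrite -(ler_pM2r p4); apply: (@le_trans _ _ 1).
  by rewrite -[leRHS](expRxMexpNx_1 y) ler_wpM2l// expR_ge0.
(* Written in z = 1 - y >= 0, the difference of the two polynomials is y^2 times a polynomial with
   positive coefficients. *)
pose z := 1 - y.
have z0 : 0 <= z by rewrite /z; lra.
have z1 : z <= 1 by rewrite /z; lra.
have -> : y = 1 - z by rewrite /z; ring.
rewrite -subr_ge0.
rewrite (_ : _ - _ = (1 - z) ^+ 2 * ((29 + 166 * z + 87 * z ^+ 2 + 56 * z ^+ 3
    + 35 * z ^+ 4 + 10 * z ^+ 5 + z ^+ 6) / 1024)); last by field.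
apply: mulr_ge0; first exact: sqr_ge0.
apply: divr_ge0; last exact: ler0n.
have := (exprn_ge0 2 z0, exprn_ge0 3 z0, exprn_ge0 4 z0, exprn_ge0 5 z0, exprn_ge0 6 z0).
by move=> [[[[]]]]; lra.
Qed.

(** The form s^2 A + 2 s t C + t^2 B is a sum of squares, and its value at (-C, A) is A (A B - C^2).
    If A = 0, every [a i] vanishes. *)
Lemma cauchy_schwarz_sum (R : realType) (I : finType) (a b : I -> R) :
  (\sum_i a i * b i) ^+ 2 <= (\sum_i a i ^+ 2) * (\sum_i b i ^+ 2).
Proof.
set A := \sum_i a i ^+ 2; set B := \sum_i b i ^+ 2; set C := \sum_i a i * b i.
have q s t : 0 <= s ^+ 2 * A + 2 * s * t * C + t ^+ 2 * B.
  rewrite /A /B /C !mulr_sumr -!big_split/=; apply: sumr_ge0 => i _.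
  rewrite (_ : _ + _ = (s * a i + t * b i) ^+ 2) ?sqr_ge0//; ring.
have A0 : 0 <= A by apply: sumr_ge0 => i _; exact: sqr_ge0.
have [A00|A00] := eqVneq A 0.
  rewrite A00 mul0r /C big1 ?expr0n// => i _.
  have /(_ i isT)/eqP := psumr_eq0P (fun i _ => sqr_ge0 (a i)) A00.
  by rewrite sqrf_eq0 => /eqP ->; rewrite mul0r.
have {A00}A0 : 0 < A by rewrite lt_def A00.
have := q (- C) A.
rewrite (_ : _ + _ = A * (A * B - C ^+ 2)); last by ring.
by rewrite pmulr_rge0// subr_ge0.
Qed.

Lemma bounded_integrable d (X : measurableType d) (R : realType)
    (PX : probability X R) (f : X -> R) (c : R) :
  measurable_fun setT f -> (forall z, `|f z| <= c) ->
  PX.-integrable setT (EFin \o f).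
Proof.
move=> mf fc; apply: measurable_bounded_integrable => //.
  exact: fin_num_fun_lty.
exists c; split; first exact: num_real.
by move=> x cx z _ /=; rewrite (le_trans (fc z))// ltW.
Qed.

(** * A dimension-free Hoeffding inequality for sums of bounded centred vectors *)

Section hilbert_hoeffding.
Context {R : realType} {dX : measure_display} {X : measurableType dX}.
Variables (PX : probability X R) (m : nat) (psi : 'I_m -> X -> R) (M2 : R).
Hypothesis mpsi : forall i, measurable_fun setT (psi i).
Hypothesis psi_bound : forall z, \sum_(i < m) psi i z ^+ 2 <= M2.
Hypothesis psi_centered : forall i, Rintegral PX setT (psi i) = 0.
Hypothesis M2_gt0 : 0 < M2.

Definition sqnorm (t : m.-tuple R) : R := \sum_(i < m) tnth t i ^+ 2.

Definition psi_shift (p : m.-tuple R * X) : m.-tuple R :=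
  [tuple tnth p.1 i + psi i p.2 | i < m].

Lemma measurable_sqnorm : measurable_fun setT sqnorm.
Proof.
apply: measurable_sum => i; apply: measurable_funX; exact: measurable_tnth.
Qed.

Lemma measurable_psi_shift : measurable_fun setT psi_shift.
Proof.
apply/measurable_fun_tnthP => i.
rewrite (_ : _ \o _ = (fun p : m.-tuple R * X => tnth p.1 i + psi i p.2)); last first.
  by apply/funext => p /=; rewrite tnth_mktuple.
apply: measurable_funD.
  exact: (measurableT_comp (measurable_tnth i)).
exact: (measurableT_comp (mpsi i)).
Qed.

Lemma psi_integrable i : PX.-integrable setT (EFin \o psi i).
Proof.
(* The bound [M2 + 1] comes from |p| <= p^2 + 1. *)
apply: (@bounded_integrable _ _ _ _ _ (M2 + 1)) => // z.
have h : psi i z ^+ 2 <= M2.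
  apply: le_trans (psi_bound z); rewrite (bigD1 i)//= lerDl.
  by apply: sumr_ge0 => j _; exact: sqr_ge0.
by rewrite ler_norml; apply/andP; split; nra.
Qed.

Lemma sqnorm_psi_shift t z :
  sqnorm (psi_shift (t, z)) = sqnorm t + 2 * (\sum_i tnth t i * psi i z)
    + \sum_i psi i z ^+ 2.
Proof.
rewrite /sqnorm mulr_sumr -!big_split/=; apply: eq_bigr => i _.
rewrite tnth_mktuple/=; ring.
Qed.

(** In |t + psi|^2 = |t|^2 + 2 <t, psi> + |psi|^2 the last term is at most [M2] and goes into [c'].
    For y = 2 l <t, psi>, exp y <= y + exp (y^2): the linear term has mean zero, and y^2 <= 4 l^2 M2
    |t|^2 goes into [l']. *)
Lemma psi_shift_step (l l' c c' : R) (t : m.-tuple R) :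
  0 <= l -> l + 4 * l ^+ 2 * M2 <= l' -> c + l * M2 <= c' ->
  (\int[PX]_z (expR (l * sqnorm (psi_shift (t, z)) + c))%:E
   <= (expR (l' * sqnorm t + c'))%:E)%E.
Proof.
move=> l0 ll' cc'.
have t0 : 0 <= sqnorm t by apply: sumr_ge0 => i _; exact: sqr_ge0.
(* [g] is the mean-zero linear term, with the constant factor [E0] in front; [D] is the target
   bound. *)
pose E0 := expR (l * sqnorm t + c + l * M2).
pose D := expR (l' * sqnorm t + c').
pose g z := \sum_i (E0 * 2 * l * tnth t i) * psi i z.
have fg z : expR (l * sqnorm (psi_shift (t, z)) + c) <= g z + D.
  rewrite sqnorm_psi_shift; set ip := \sum_i tnth t i * psi i z.
  have -> : g z = E0 * (2 * l * ip).
    by rewrite /g /ip !mulr_sumr; apply: eq_bigr => i _; ring.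
  apply: (@le_trans _ _ (E0 * expR (2 * l * ip))).
    rewrite /E0 -expRD ler_expR.
    by have := psi_bound z; set q := \sum_i _ => qM; nra.
  apply: (@le_trans _ _ (E0 * (2 * l * ip + expR ((2 * l * ip) ^+ 2)))).
    by rewrite ler_wpM2l ?expR_ge0// expR_le_add_expR_sqr.
  rewrite mulrDr lerD2l /E0 /D -expRD ler_expR.
  have ipb : ip ^+ 2 <= sqnorm t * M2.
    by apply: le_trans (cauchy_schwarz_sum _ _) _; rewrite ler_wpM2l.
  have -> : (2 * l * ip) ^+ 2 = 4 * l ^+ 2 * ip ^+ 2 by ring.
  have : 4 * l ^+ 2 * ip ^+ 2 <= 4 * l ^+ 2 * (sqnorm t * M2).
    by rewrite ler_wpM2l// mulr_ge0// sqr_ge0.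
  have : (l + 4 * l ^+ 2 * M2) * sqnorm t <= l' * sqnorm t by rewrite ler_wpM2r.
  by lra.
have ig i : PX.-integrable setT
    (fun z => ((E0 * 2 * l * tnth t i)%:E * (psi i z)%:E)%E).
  by apply: integrableZl => //; exact: psi_integrable.
have gE z : ((g z)%:E = \sum_i ((E0 * 2 * l * tnth t i)%:E * (psi i z)%:E))%E.
  by rewrite /g -sumEFin; apply: eq_bigr => i _; rewrite EFinM.
have int_g : (\int[PX]_z (g z)%:E = 0)%E.
  under eq_integral do rewrite gE.
  rewrite integral_sum//; apply: big1 => i _.
  rewrite integralZl//; last exact: psi_integrable.
  have := psi_centered i; rewrite /Rintegral => h.
  rewrite -[X in (_ * X)%E]fineK ?h ?mule0//.
  by apply: integrable_fin_num => //; exact: psi_integrable.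
have igT : PX.-integrable setT (EFin \o g).
  rewrite (_ : _ \o _ = fun z => (\sum_i ((E0 * 2 * l * tnth t i)%:E * (psi i z)%:E))%E).
    exact: integrable_sum.
  by apply/funext => z; exact: gE.
have iD : PX.-integrable setT (EFin \o (cst D : X -> R)).
  exact: finite_measure_integrable_cst.
apply: (@le_trans _ _ (\int[PX]_z (g z + D)%:E)%E).
  apply: ge0_le_integral => //=.
  - apply/measurable_EFinP; apply: measurableT_comp => //.
    apply: measurable_funD => //; apply: measurable_funM => //.
    apply: (measurableT_comp measurable_sqnorm).
    by apply: (measurableT_comp measurable_psi_shift); exact: measurable_fun_pair.
  - by apply/measurable_EFinP; apply: measurable_funD => //;
      move/integrableP: igT => [/measurable_EFinP].
  - by move=> z _; rewrite lee_fin.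
under eq_integral do rewrite EFinD.
rewrite integralD_EFin// int_g add0e integral_cst//.
by rewrite [X in (_ * X)%E](_ : _ = 1%E) ?mule1//; exact: probability_setT.
Qed.

Lemma tnth_iteri_psi_shift n (y : nat -> X) (t : m.-tuple R) i :
  tnth (iteri n (fun j t => psi_shift (t, y j)) t) i
  = tnth t i + \sum_(j < n) psi i (y j).
Proof.
elim: n => [|n IH]; first by rewrite big_ord0 addr0.
by rewrite big_ord_recr/= tnth_mktuple/= IH addrA.
Qed.

(* [exp (l_j |S_j|^2 + c_j)] is a supermartingale for [1 / l_j = 4 M2 (n + j)],
   because [1/p + 1/p^2 <= 1/(p - 1)] with [p = n + j + 1]. *)
Lemma hilbert_hoeffding dO (Omega : measurableType dO)
    (nu : {finite_measure set Omega -> \bar R}) n (y : nat -> Omega -> X) (u : R) :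
  (0 < n)%N -> (forall i, measurable_fun setT (y i)) ->
  (forall C : nat -> set X, (forall i, measurable (C i)) ->
    nu [set w | forall i, (i < n)%N -> C i (y i w)]
    = nu setT * \prod_(i < n) PX (C i))%E ->
  (nu [set w | u <= \sum_(i < m) (\sum_(j < n) psi i (y j w)) ^+ 2]%R
   <= (expR (1 / 4 - u / (8 * M2 * n%:R)))%:E * nu setT)%E.
Proof.
move=> n0 my ind.
pose t0 : m.-tuple R := [tuple 0 | i < m].
(* The initial state is constant, so [A] holds everywhere or nowhere, and the rule on the draws
   alone suffices. *)
have indY : independent_draws nu PX n (fun=> t0) y.
  move=> A C mA mC; have [At0|At0] := pselect (A t0).
    rewrite (_ : [set _ | _] = [set w | forall i, (i < n)%N -> C i (y i w)]).
      by rewrite ind// (_ : _ @^-1` A = setT)//; apply/seteqP; split.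
    by apply/seteqP; split => w /=; tauto.
  rewrite (_ : [set _ | _] = set0); last by apply/seteqP; split => w /= [].
  rewrite (_ : _ @^-1` A = set0); last by apply/seteqP; split.
  by rewrite measure0 mul0e.
have nR : 0 < n%:R :> R by rewrite ltr0n.
pose l j : R := (4 * M2 * (n%:R + j%:R))^-1.
(* [c] falls from 1/4 to 0 in steps of 1 / (4 n), which pay for l_(j+1) M2 = 1 / (4 (n + j + 1)). At
   the end l_n = 1 / (8 M2 n). *)
pose c j : R := (n%:R - j%:R) / (4 * n%:R).
pose V j (t : m.-tuple R) := (expR (l j * sqnorm t + c j))%:E.
have mV j : measurable_fun setT (V j).
  apply/measurable_EFinP; apply: measurableT_comp => //.
  by apply: measurable_funD => //; apply: measurable_funM => //; exact: measurable_sqnorm.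
have V0 j t : (0 <= V j t)%E by rewrite lee_fin expR_ge0.
have Vstep j t : (j < n)%N -> (\int[PX]_z V j.+1 (psi_shift (t, z)) <= V j t)%E.
  move=> jn; have p0 : 0 < n%:R + j%:R :> R by rewrite -natrD ltr0n addn_gt0 n0.
  apply: psi_shift_step.
  - by rewrite invr_ge0 !mulr_ge0 ?ltW// -natrD.
  - rewrite /l -(natr1 j) addrA; set p := n%:R + j%:R in p0 *.
    rewrite -subr_ge0 (_ : _ - _ = (4 * M2 * p * (p + 1) ^+ 2)^-1).
      rewrite invr_ge0; apply: mulr_ge0; last exact: sqr_ge0.
      by rewrite !mulr_ge0// ltW.
    by field; rewrite !gt_eqF//; lra.
  - rewrite /c /l -(natr1 j).
    have -> : (4 * M2 * (n%:R + (j%:R + 1)))^-1 * M2 = (4 * (n%:R + (j%:R + 1)))^-1 :> R.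
      by field; rewrite !gt_eqF//; lra.
    have -> : (n%:R - j%:R) / (4 * n%:R) = (n%:R - (j%:R + 1)) / (4 * n%:R) + (4 * n%:R)^-1 :> R.
      by field; rewrite !gt_eqF//; lra.
    have j0 : 0 <= j%:R :> R by [].
    by rewrite lerD2l lef_pV2 ?posrE//; lra.
have := independent_draws_supermartingale measurable_psi_shift mV V0 Vstep
  (measurable_cst t0) my indY.
set S := fun w => iteri n (fun j t => psi_shift (t, y j w)) t0.
have SE w : sqnorm (S w) = \sum_(i < m) (\sum_(j < n) psi i (y j w)) ^+ 2.
  by apply: eq_bigr => i _; rewrite tnth_iteri_psi_shift tnth_mktuple add0r.
rewrite -/(S _) => H.
have mS : measurable_fun setT (fun w => V n (S w)).
  apply: (measurableT_comp (mV n)); apply/measurable_fun_tnthP => i.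
  rewrite (_ : _ \o _ = fun w => \sum_(j < n) psi i (y j w)); last first.
    by apply/funext => w /=; rewrite tnth_iteri_psi_shift tnth_mktuple add0r.
  by apply: measurable_sum => j; exact: measurableT_comp.
(* Markov's inequality for [V n], at the value that it takes when the squared norm of the sum is
   [u]. *)
have a0 : 0 < expR (u / (8 * M2 * n%:R)) by exact: expR_gt0.
have := le_integral_abse nu measurableT mS a0.
under eq_integral do rewrite gee0_abs//.
move=> /le_trans /(_ H).
rewrite [X in (_ <= X)%E -> _](integral_cst nu measurableT (V 0%N t0)) setTI.
have t00 : sqnorm t0 = 0 by apply: big1 => i _; rewrite tnth_mktuple expr0n.
have -> : V 0%N t0 = (expR (1 / 4))%:E.
  congr (expR _)%:E; rewrite t00 mulr0 add0r /c subr0.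
  by field; rewrite gt_eqF.
rewrite (_ : [set _ | _] =
    [set w | u <= \sum_(i < m) (\sum_(j < n) psi i (y j w)) ^+ 2]); last first.
  apply/seteqP; split => w /=; rewrite lee_fin ger0_norm ?expR_ge0// ler_expR SE /c subrr mul0r addr0.
    rewrite mulrC (_ : l n = (8 * M2 * n%:R)^-1) ?ler_pM2l ?invr_gt0 ?mulr_gt0//.
    by rewrite /l; congr (_ ^-1); ring.
  rewrite mulrC (_ : l n = (8 * M2 * n%:R)^-1) ?ler_pM2l ?invr_gt0 ?mulr_gt0//.
  by rewrite /l; congr (_ ^-1); ring.
set x := u / _; move=> h.
rewrite addrC expRD EFinM -muleA.
have h' := lee_wpmul2l (x := (expR (- x))%:E) _ h.
apply: le_trans (h' _); last by rewrite lee_fin expR_ge0.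
by rewrite muleA -EFinM -expRD addNr expR0 mul1e.
Qed.

End hilbert_hoeffding.

(** * Euclidean and Frobenius norms, coercive matrices, the Rayleigh quotient *)

Section euclidean.
Variable R : realType.

Definition dot n (u v : 'cV[R]_n) : R := (u^T *m v) 0 0.

Definition frob m n (A : 'M[R]_(m, n)) : R :=
  Num.sqrt (\sum_(i < m) \sum_(j < n) A i j ^+ 2).

Lemma dotE n (u v : 'cV[R]_n) : dot u v = \sum_i u i 0 * v i 0.
Proof. by rewrite /dot mxE; apply: eq_bigr => i _; rewrite mxE. Qed.

Lemma dotC n (u v : 'cV[R]_n) : dot u v = dot v u.
Proof. by rewrite !dotE; apply: eq_bigr => i _; rewrite mulrC. Qed.

Lemma dotDr n (u v w : 'cV[R]_n) : dot u (v + w) = dot u v + dot u w.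
Proof. by rewrite /dot mulmxDr mxE. Qed.

Lemma dotZr n a (u v : 'cV[R]_n) : dot u (a *: v) = a * dot u v.
Proof. by rewrite /dot -scalemxAr mxE. Qed.

Lemma dotDl n (u v w : 'cV[R]_n) : dot (u + v) w = dot u w + dot v w.
Proof. by rewrite dotC dotDr !(dotC w). Qed.

Lemma dotZl n a (u v : 'cV[R]_n) : dot (a *: u) v = a * dot u v.
Proof. by rewrite dotC dotZr dotC. Qed.

Lemma dot_mulmx m n (A : 'M[R]_(m, n)) u v : dot u (A *m v) = dot (A^T *m u) v.
Proof. by rewrite /dot trmx_mul trmxK mulmxA. Qed.

Lemma norm2_ge0 n (v : 'cV[R]_n) : 0 <= norm2 v.
Proof. exact: sqrtr_ge0. Qed.

Lemma frob_ge0 m n (A : 'M[R]_(m, n)) : 0 <= frob A.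
Proof. exact: sqrtr_ge0. Qed.

Lemma norm2_sqr n (v : 'cV[R]_n) : norm2 v ^+ 2 = dot v v.
Proof.
rewrite sqr_sqrtr; last by apply: sumr_ge0 => i _; exact: sqr_ge0.
by rewrite dotE; apply: eq_bigr.
Qed.

Lemma frob_sqr m n (A : 'M[R]_(m, n)) :
  frob A ^+ 2 = \sum_(i < m) \sum_(j < n) A i j ^+ 2.
Proof.
by rewrite sqr_sqrtr// sumr_ge0// => i _; rewrite sumr_ge0// => j _; exact: sqr_ge0.
Qed.

Lemma norm2_eq0 n (v : 'cV[R]_n) : norm2 v = 0 -> v = 0.
Proof.
move=> v0; have := norm2_sqr v; rewrite v0 expr0n/= dotE => /esym h.
apply/matrixP => i j; rewrite ord1 mxE; apply/eqP; rewrite -sqrf_eq0 expr2.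
by apply/eqP; have /(_ i isT) := psumr_eq0P (fun i _ => sqr_ge0 (v i 0)) h.
Qed.

Lemma dot_le_norm2 n (u v : 'cV[R]_n) : `|dot u v| <= norm2 u * norm2 v.
Proof.
rewrite -[leRHS]ger0_norm ?mulr_ge0 ?norm2_ge0// -ler_sqr ?nnegrE ?normr_ge0//.
rewrite !real_normK ?num_real// exprMn !norm2_sqr !dotE; exact: cauchy_schwarz_sum.
Qed.

Lemma norm2D n (u v : 'cV[R]_n) : norm2 (u + v) <= norm2 u + norm2 v.
Proof.
rewrite -ler_sqr ?nnegrE ?addr_ge0 ?norm2_ge0// norm2_sqr dotDr !dotDl.
rewrite sqrrD !norm2_sqr (dotC v u).
by have := le_trans (ler_norm _) (dot_le_norm2 u v); lra.
Qed.

Lemma norm2Z n a (v : 'cV[R]_n) : norm2 (a *: v) = `|a| * norm2 v.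
Proof.
apply/eqP; rewrite -(eqrXn2 (n := 2))// ?mulr_ge0 ?norm2_ge0//.
by rewrite exprMn !norm2_sqr dotZl dotZr real_normK ?num_real// expr2 mulrA.
Qed.

Lemma norm2_mulmx m n (A : 'M[R]_(m, n)) v : norm2 (A *m v) <= frob A * norm2 v.
Proof.
rewrite -ler_sqr ?nnegrE ?mulr_ge0 ?norm2_ge0 ?frob_ge0//.
rewrite exprMn !norm2_sqr frob_sqr !dotE mulr_suml; apply: ler_sum => i _.
by rewrite -expr2 mxE; exact: cauchy_schwarz_sum.
Qed.

Lemma frob_tr m n (A : 'M[R]_(m, n)) : frob A^T = frob A.
Proof.
rewrite /frob exchange_big/=; congr Num.sqrt.
by apply: eq_bigr => i _; apply: eq_bigr => j _; rewrite mxE.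
Qed.

Lemma spec_norm_le m n (A : 'M[R]_(m, n)) c :
  (forall v, norm2 v <= 1 -> norm2 (A *m v) <= c) -> spec_norm A <= c.
Proof.
move=> Ac; apply: ge_sup; last by move=> _ [v v1 <-]; exact: Ac.
exists (norm2 (A *m 0)); exists 0 => //=.
by rewrite -(scale0r 0) norm2Z normr0 mul0r.
Qed.

(** If a row vector v satisfies v A = 0, the quadratic form vanishes at its transpose, so coercivity
    forces v = 0. *)
Lemma coercive_unitmx n (A : 'M[R]_n) c : 0 < c ->
  (forall v, c * norm2 v ^+ 2 <= dot v (A *m v)) -> A \in unitmx.
Proof.
move=> c0 Ac; rewrite -row_free_unit -kermx_eq0; apply/rowV0P => v /sub_kermxP vA.
have := Ac v^T; rewrite /dot trmxK mulmxA vA mul0mx mxE => h.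
have : norm2 v^T ^+ 2 <= 0 by rewrite -(ler_pM2l c0) mulr0.
have := sqr_ge0 (norm2 v^T) => h1 h2.
have /eqP : norm2 v^T ^+ 2 = 0 by apply/le_anti/andP.
by rewrite sqrf_eq0 => /eqP/norm2_eq0/(congr1 trmx); rewrite trmxK trmx0.
Qed.

(** For v = A^-1 w, c |v|^2 <= <v, A v> = <v, w> <= |v| |w|; then divide by |v|. *)
Lemma norm2_invmx_coercive n (A : 'M[R]_n) c w : 0 < c ->
  (forall v, c * norm2 v ^+ 2 <= dot v (A *m v)) ->
  norm2 (invmx A *m w) <= c^-1 * norm2 w.
Proof.
move=> c0 Ac; have uA := coercive_unitmx c0 Ac.
set v := invmx A *m w.
have wE : w = A *m v by rewrite /v mulKVmx.
have [v0|v0] := eqVneq (norm2 v) 0.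
  by rewrite v0 mulr_ge0 ?norm2_ge0// invr_ge0 ltW.
have {}v0 : 0 < norm2 v by rewrite lt_def v0 norm2_ge0.
rewrite ler_pdivlMl// -(ler_pM2r v0) -mulrA -expr2.
apply: le_trans (Ac v) _; rewrite -wE mulrC.
exact: le_trans (ler_norm _) (dot_le_norm2 _ _).
Qed.

Lemma psd_cauchy_schwarz n (B : 'M[R]_n) (u v : 'cV[R]_n) :
  B^T = B -> (forall w, 0 <= dot w (B *m w)) ->
  dot u (B *m v) ^+ 2 <= dot u (B *m u) * dot v (B *m v).
Proof.
move=> Bs B0.
set a := dot u (B *m u); set b := dot v (B *m v); set c := dot u (B *m v).
have q s t : 0 <= s ^+ 2 * a + 2 * s * t * c + t ^+ 2 * b.
  have := B0 (s *: u + t *: v).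
  rewrite mulmxDr -!scalemxAr dotDr !dotDl !dotZr !dotZl.
  rewrite (_ : dot v (B *m u) = c); last by rewrite dot_mulmx Bs dotC.
  by rewrite -/a -/b -/c; congr (_ <= _); ring.
have a0 : 0 <= a by exact: B0.
have b0 : 0 <= b by exact: B0.
have [a00|a00] := eqVneq a 0.
  have [->|c0] := eqVneq c 0; first by rewrite expr0n mulr_ge0.
  (* When a = 0 the form is affine in s at t = 1; this s makes it equal to -1. *)
  have := q (- (b + 1) / (2 * c)) 1.
  rewrite a00 (_ : _ + _ = -1); first by lra.
  by field.
have {}a0 : 0 < a by rewrite lt_def a00.
have := q (- c) a; rewrite (_ : _ + _ = a * (a * b - c ^+ 2)); last by ring.
by rewrite pmulr_rge0// subr_ge0.
Qed.

(* If the infimum [m] of the Rayleigh quotient were not an eigenvalue, [A - m]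
   would be positive semidefinite and invertible, hence coercive by
   [psd_cauchy_schwarz], contradicting that [m] is an infimum. *)
Lemma lambda_min_le_rayleigh n (A : 'M[R]_n) v : A^T = A ->
  lambda_min A * norm2 v ^+ 2 <= dot v (A *m v).
Proof.
(* The zero vector is set aside. This settles dimension 0, where the infima are over empty sets. *)
move=> As; have [v0|v0] := eqVneq (norm2 v) 0.
  by rewrite v0 expr0n mulr0 (norm2_eq0 v0) mulmx0 /dot mulmx0 mxE.
pose Q := [set dot w (A *m w) | w in [set w : 'cV[R]_n | norm2 w = 1]].
pose m := inf Q.
have scaled w : norm2 w != 0 -> Q (dot w (A *m w) / norm2 w ^+ 2).
  move=> w0; exists ((norm2 w)^-1 *: w) => /=.
    by rewrite norm2Z ger0_norm ?invr_ge0 ?norm2_ge0// mulVf.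
  by rewrite -scalemxAr dotZr dotZl; field.
have Qlb : has_lbound Q.
  exists (- frob A) => _ [w /= w1 <-].
  have := le_trans (dot_le_norm2 w (A *m w)) (ler_wpM2l (norm2_ge0 w) (norm2_mulmx A w)).
  by rewrite w1 !mulr1 mul1r ler_norml => /andP[].
have mQ w : m * norm2 w ^+ 2 <= dot w (A *m w).
  have [w0|w0] := eqVneq (norm2 w) 0.
    by rewrite w0 expr0n mulr0 (norm2_eq0 w0) mulmx0 /dot mulmx0 mxE.
  rewrite -ler_pdivlMr ?exprn_gt0 ?lt_def ?w0 ?norm2_ge0//.
  exact: (ge_inf Qlb (scaled w w0)).
pose B := A - m%:M.
have Bq w : dot w (B *m w) = dot w (A *m w) - m * norm2 w ^+ 2.
  by rewrite mulmxBl mul_scalar_mx -scaleNr dotDr dotZr norm2_sqr mulNr.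
have B0 w : 0 <= dot w (B *m w) by rewrite Bq subr_ge0.
have Bs : B^T = B by rewrite linearB/= As tr_scalar_mx.
have em : eigenvalue A m.
  rewrite /eigenvalue /eigenspace kermx_eq0 row_free_unit; apply/negP => uB.
  (* The added 1 only ensures c > 0. *)
  pose c := frob (invmx B) + 1.
  have c0 : 0 < c by rewrite ltr_wpDl// frob_ge0.
  have : m + c^-1 <= m.
    apply: lb_le_inf; first by eexists; exact: scaled v0.
    move=> _ [w /= w1 <-].
    (* For a unit vector w this reads 1 <= e d with e = <w, B w> and d = <B^-1 w, w> <= c. Hence e
       >= 1/c, and m + 1/c would bound the quotient from below. *)
    have := psd_cauchy_schwarz w (invmx B *m w) Bs B0.
    rewrite mulKVmx// -norm2_sqr w1 !expr1n Bq w1 expr1n mulr1.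
    set d := dot (invmx B *m w) w; set e := _ - m => de.
    have e0 : 0 <= e by rewrite /e -[m]mulr1 -(expr1n R 2) -w1 subr_ge0.
    have dc : d <= c.
      apply: le_trans (ler_norm _) _; apply: le_trans (dot_le_norm2 _ _) _.
      rewrite w1 mulr1; apply: le_trans (norm2_mulmx _ _) _.
      by rewrite w1 mulr1 lerDl.
    rewrite addrC -lerBrDr -/e -[c^-1]mul1r ler_pdivrMr//.
    exact: le_trans de (ler_wpM2l e0 dc).
  by rewrite gerDl invr_le0 leNgt c0.
have lam_m : lambda_min A <= m.
  (* [ge_inf] requires the eigenvalues to be bounded below; [m] is such a bound, because an
     eigenvalue is the Rayleigh quotient of its eigenvector. Eigenvectors are rows, hence the
     transposes. *)
  apply: ge_inf => //; exists m => a /= /eigenvalueP[w wA w0].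
  have wT : norm2 w^T != 0.
    by apply: contra_neq w0 => /norm2_eq0/(congr1 trmx); rewrite trmxK trmx0.
  have := mQ w^T; rewrite /dot trmxK mulmxA wA -scalemxAl mxE.
  have -> : (w *m w^T) 0 0 = norm2 w^T ^+ 2 by rewrite norm2_sqr /dot trmxK.
  by rewrite ler_pM2r// exprn_gt0// lt_def wT norm2_ge0.
by apply: le_trans (mQ v); rewrite ler_wpM2r// sqr_ge0.
Qed.

End euclidean.

(** * Perturbation of the posterior covariance *)

Section posterior.
Variable R : realType.

Lemma coercive_perturbation n (S T : 'M[R]_n) lam u v :
  (forall v, lam * norm2 v ^+ 2 <= dot v (S *m v)) -> frob (T - S) <= u ->
  (lam - u) * norm2 v ^+ 2 <= dot v (T *m v).
Proof.
move=> Slam TSu; have -> : T = S + (T - S) by rewrite addrC subrK.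
rewrite mulmxDl dotDr mulrBl; apply: lerD => //.
have h : `|dot v ((T - S) *m v)| <= u * norm2 v ^+ 2.
  apply: le_trans (dot_le_norm2 _ _) _; rewrite mulrC expr2 mulrA.
  apply: ler_wpM2r; first exact: norm2_ge0.
  apply: le_trans (norm2_mulmx _ _) _.
  by apply: ler_wpM2r => //; exact: norm2_ge0.
by move: h; rewrite ler_norml => /andP[].
Qed.

Lemma norm2_resolvent_diff n (S T1 T2 : 'M[R]_n) lam u a v :
  0 < a -> 0 < lam -> 0 <= u -> 3 * u <= lam ->
  (forall v, lam * norm2 v ^+ 2 <= dot v (S *m v)) ->
  frob (T1 - S) <= u -> frob (T2 - S) <= u ->
  norm2 ((invmx (a *: T1 + 1%:M) - invmx (a *: T2 + 1%:M)) *m v)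
  <= 3 * u / (4 * lam) * norm2 v.
Proof.
move=> a0 lam0 u0 ulam Slam T1S T2S.
(* Since 3 u <= lam, both [T1] and [T2] keep the coercivity constant lam - u >= z, so [c] serves for
   both shifted matrices. *)
pose z := 2 / 3 * lam; pose c := 1 + a * z.
have z0 : 0 < z by rewrite mulr_gt0// divr_gt0.
have c0 : 0 < c by rewrite ltr_wpDr// mulr_ge0 ?ltW.
have coer T : frob (T - S) <= u -> forall w,
    c * norm2 w ^+ 2 <= dot w ((a *: T + 1%:M) *m w).
  move=> TS w; rewrite mulmxDl mul1mx -scalemxAl dotDr dotZr -norm2_sqr mulrDl mul1r.
  rewrite addrC lerD2r -mulrA ler_pM2l//.
  apply: le_trans (coercive_perturbation w Slam TS).
  by rewrite ler_wpM2r ?sqr_ge0// /z; lra.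
have u1 := coercive_unitmx c0 (coer _ T1S); have u2 := coercive_unitmx c0 (coer _ T2S).
set A1 := a *: T1 + 1%:M in u1 *; set A2 := a *: T2 + 1%:M in u2 *.
have -> : invmx A1 - invmx A2 = invmx A1 *m (a *: (T2 - T1)) *m invmx A2.
  have -> : a *: (T2 - T1) = A2 - A1 by rewrite /A1 /A2 opprD addrACA subrr addr0 scalerBr.
  by rewrite mulmxBr mulmxBl mulVmx// mul1mx mulmxK.
rewrite -!mulmxA; set w := invmx A2 *m v.
have wv : norm2 w <= c^-1 * norm2 v by exact: norm2_invmx_coercive c0 (coer _ T2S).
apply: le_trans (norm2_invmx_coercive _ c0 (coer _ T1S)) _.
have h : norm2 (a *: (T2 - T1) *m w) <= a * (2 * u) * (c^-1 * norm2 v).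
  rewrite -scalemxAl norm2Z gtr0_norm// -mulrA ler_pM2l//.
  have -> : T2 - T1 = (T2 - S) + (S - T1) by rewrite addrA subrK.
  rewrite mulmxDl; apply: le_trans (norm2D _ _) _.
  have -> : (S - T1) *m w = (-1) *: ((T1 - S) *m w).
    by rewrite scaleN1r -mulNmx opprB.
  rewrite norm2Z normrN1 mul1r.
  have := ler_wpM2r (norm2_ge0 w) T1S; have := ler_wpM2r (norm2_ge0 w) T2S.
  have := norm2_mulmx (T1 - S) w; have := norm2_mulmx (T2 - S) w.
  have := ler_wpM2l u0 wv.
  by lra.
apply: le_trans (ler_wpM2l _ h) _; first by rewrite invr_ge0 ltW.
have -> : c^-1 * (a * (2 * u) * (c^-1 * norm2 v)) = 2 * u * a / c ^+ 2 * norm2 v.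
  by field; rewrite gt_eqF.
apply: ler_wpM2r; first exact: norm2_ge0.
(* AM-GM: [4 a z <= (1 + a z)^2] *)
have amgm : 4 * (a * z) <= c ^+ 2.
  by rewrite -subr_ge0 (_ : _ - _ = (1 - a * z) ^+ 2) ?sqr_ge0// /c; ring.
rewrite ler_pdivrMr ?exprn_gt0//.
have -> : 2 * u * a = 3 * u / (4 * lam) * (4 * (a * z)).
  by rewrite /z; field; rewrite gt_eqF.
by rewrite ler_wpM2l// divr_ge0// mulr_ge0// ltW.
Qed.

Lemma frob_Phi_mat (X : Type) r (phi : X -> 'cV[R]_r) K N' (xs' : 'I_N' -> X) :
  (forall z, norm2 (phi z) <= K) ->
  frob (Phi_mat phi xs') ^+ 2 <= N'%:R * K ^+ 2.
Proof.
move=> phiK; rewrite frob_sqr.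
apply: (@le_trans _ _ (\sum_(i < N') K ^+ 2)); last first.
  by rewrite sumr_const card_ord mulr_natl.
apply: ler_sum => i _.
have -> : \sum_(j < r) Phi_mat phi xs' i j ^+ 2 = norm2 (phi (xs' i)) ^+ 2.
  by rewrite norm2_sqr dotE; apply: eq_bigr => j _; rewrite mxE expr2.
have K0 : 0 <= K by exact: le_trans (norm2_ge0 _) (phiK (xs' i)).
by rewrite lerXn2r ?nnegrE ?norm2_ge0.
Qed.

(** The difference is P (R1 - R2) P^T, with P the test feature matrix and R1, R2 the resolvents.
    Each outer factor costs [frob P], and the square of [frob P] produces N' K^2. *)
Lemma spec_norm_S_post_diff (X : Type) r (phi : X -> 'cV[R]_r) sigma2 N
    (S T1 T2 : 'M[R]_r) lam u K N' (xs' : 'I_N' -> X) :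
  0 < sigma2 -> (0 < N)%N -> 0 < lam -> 0 <= u -> 3 * u <= lam ->
  (forall z, norm2 (phi z) <= K) ->
  (forall v, lam * norm2 v ^+ 2 <= dot v (S *m v)) ->
  frob (T1 - S) <= u -> frob (T2 - S) <= u ->
  spec_norm (S_post phi sigma2 N T1 xs' - S_post phi sigma2 N T2 xs')
  <= N'%:R * K ^+ 2 * (3 * u / (4 * lam)).
Proof.
move=> s0 N0 lam0 u0 ulam phiK Slam T1S T2S; apply: spec_norm_le => v v1.
rewrite /S_post -mulmxBl -mulmxBr; set P := Phi_mat _ _; rewrite -!mulmxA.
have a0 : 0 < sigma2^-1 * N%:R by rewrite mulr_gt0 ?invr_gt0// ltr0n.
have c0 : 0 <= 3 * u / (4 * lam) by rewrite divr_ge0// mulr_ge0// ltW.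
set c := 3 * u / _ in c0 *.
apply: le_trans (norm2_mulmx _ _) _.
apply: le_trans (ler_wpM2l (frob_ge0 _)
  (norm2_resolvent_diff _ a0 lam0 u0 ulam Slam T1S T2S)) _.
have h : norm2 (P^T *m v) <= frob P.
  apply: le_trans (norm2_mulmx _ _) _; rewrite frob_tr.
  by rewrite -[leRHS]mulr1 ler_wpM2l// frob_ge0.
apply: le_trans (ler_wpM2l (frob_ge0 P) (ler_wpM2l c0 h)) _.
rewrite mulrCA -expr2 mulrC ler_wpM2r//; exact: frob_Phi_mat.
Qed.

End posterior.

(** * Deviation of empirical second moments *)

Lemma Rintegral_lincomb d (X : measurableType d) (R : realType)
    (PX : probability X R) (I : finType) (f : I -> X -> R) (c : I -> R) :
  (forall i, PX.-integrable setT (EFin \o f i)) ->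
  PX.-integrable setT (EFin \o (fun z => \sum_i c i * f i z)) /\
  Rintegral PX setT (fun z => \sum_i c i * f i z)
    = \sum_i c i * Rintegral PX setT (f i).
Proof.
move=> fi.
have E : (EFin \o (fun z => \sum_i c i * f i z))
    = (fun z => (\sum_i ((c i)%:E * (f i z)%:E))%E).
  by apply/funext => z /=; rewrite -sumEFin; apply: eq_bigr => i _; rewrite EFinM.
have ig i : PX.-integrable setT (fun z => ((c i)%:E * (f i z)%:E)%E).
  by apply: integrableZl => //; exact: fi.
split; first by rewrite E; exact: integrable_sum.
rewrite /Rintegral; have -> : (\int[PX]_z (\sum_i c i * f i z)%:E)%E =
    (\int[PX]_z (\sum_i ((c i)%:E * (f i z)%:E)))%E.
  by apply: eq_integral => z _; rewrite -(congr1 (fun g => g z) E).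
rewrite integral_sum// (eq_bigr (fun i => (c i * Rintegral PX setT (f i))%:E)).
  by rewrite sumEFin.
move=> i _; rewrite integralZl//; last exact: fi.
by rewrite EFinM fineK// integrable_fin_num//; exact: fi.
Qed.

Lemma sum_mxvec_sqr (R : realType) m n (A : 'M[R]_(m, n)) :
  \sum_(l < m * n) mxvec A 0 l ^+ 2 = frob A ^+ 2.
Proof.
rewrite frob_sqr pair_big/=.
rewrite (reindex _ (curry_mxvec_bij _ _))/=.
by apply: eq_bigr => -[i j] _; rewrite mxvecE.
Qed.

Section second_moment.
Context {R : realType} {dX : measure_display} {X : measurableType dX}.
Variables (PX : probability X R) (r : nat) (phi : X -> 'cV[R]_r) (K : R).
Hypothesis mphi : forall i, measurable_fun setT (fun z => phi z i 0).
Hypothesis phiK : forall z, norm2 (phi z) <= K.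
Hypothesis K_gt0 : 0 < K.

Local Notation Sig := (Sigma_pop PX phi).

Lemma norm2_coord n (v : 'cV[R]_n) i : `|v i 0| <= norm2 v.
Proof.
rewrite -ler_sqr ?nnegrE ?normr_ge0 ?norm2_ge0// real_normK ?num_real//.
rewrite norm2_sqr dotE (bigD1 i)//= -expr2 lerDl.
by apply: sumr_ge0 => j _; rewrite -expr2 sqr_ge0.
Qed.

Lemma measurable_feature_product i j :
  measurable_fun setT (fun z => phi z i 0 * phi z j 0).
Proof. exact: measurable_funM. Qed.

Lemma feature_product_integrable i j :
  PX.-integrable setT (EFin \o (fun z => phi z i 0 * phi z j 0)).
Proof.
apply: (@bounded_integrable _ _ _ _ _ (K * K)).
  exact: measurable_feature_product.
by move=> z; rewrite normrM ler_pM// (le_trans (norm2_coord _ _)).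
Qed.

Lemma Sigma_pop_sym : Sig^T = Sig.
Proof.
apply/matrixP => i j; rewrite !mxE.
by apply: eq_Rintegral => z _; rewrite mulrC.
Qed.

Lemma dot_quadratic n (A : 'M[R]_n) v :
  dot v (A *m v) = \sum_(p : 'I_n * 'I_n) A p.1 p.2 * (v p.1 0 * v p.2 0).
Proof.
rewrite dotE -(pair_big xpredT xpredT
  (fun i j => A i j * (v i 0 * v j 0)))/=; apply: eq_bigr => i _.
by rewrite mxE mulr_sumr; apply: eq_bigr => j _; ring.
Qed.

(* [|Sig|_F^2 = E <phi, Sig phi> <= |Sig|_F K^2] *)
Lemma frob_Sigma_pop : frob Sig <= K ^+ 2.
Proof.
have [iL EL] := @Rintegral_lincomb _ _ _ PX _
  (fun (p : 'I_r * 'I_r) z => phi z p.1 0 * phi z p.2 0)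
  (fun p => Sig p.1 p.2) (fun p => feature_product_integrable p.1 p.2).
have E : frob Sig ^+ 2 = Rintegral PX setT (fun z => dot (phi z) (Sig *m phi z)).
  rewrite (_ : (fun z => dot _ _) = (fun z => \sum_(p : 'I_r * 'I_r)
      Sig p.1 p.2 * (phi z p.1 0 * phi z p.2 0))); last first.
    by apply/funext => z; rewrite dot_quadratic.
  rewrite EL frob_sqr pair_big/=; apply: eq_bigr => p _.
  by rewrite expr2; congr (_ * _); rewrite mxE.
have h : frob Sig ^+ 2 <= frob Sig * K ^+ 2.
  rewrite E.
  have -> : frob Sig * K ^+ 2 = Rintegral PX setT (cst (frob Sig * K ^+ 2)).
    rewrite Rintegral_cst// [X in fine X](_ : _ = 1%E) ?mulr1//.
    exact: probability_setT.
  apply: le_Rintegral => //.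
  - rewrite (_ : (fun z => dot _ _) = (fun z => \sum_(p : 'I_r * 'I_r)
      Sig p.1 p.2 * (phi z p.1 0 * phi z p.2 0)))//.
    by apply/funext => z; rewrite dot_quadratic.
  - exact: finite_measure_integrable_cst.
  - move=> z _; apply: le_trans (ler_norm _) _; apply: le_trans (dot_le_norm2 _ _) _.
    apply: le_trans (ler_wpM2l (norm2_ge0 _) (norm2_mulmx _ _)) _.
    rewrite mulrCA ler_wpM2l ?frob_ge0// expr2.
    by rewrite ler_pM ?norm2_ge0.
have [->|f0] := eqVneq (frob Sig) 0; first exact: sqr_ge0.
by rewrite -(ler_pM2l (x := frob Sig)) -?expr2// lt_def f0 frob_ge0.
Qed.

Definition feature_dev z : 'M[R]_r := phi z *m (phi z)^T - Sig.

(** Expanding the square gives |phi|^4 - 2 <phi, Sig phi> + |Sig|^2. Dropping the cross term, which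
    has a favourable sign as [Sig] is positive semidefinite, yields 2 K^4 instead of the 4 K^4 of
    the triangle inequality. *)
Lemma frob_feature_dev z : (forall v, 0 <= dot v (Sig *m v)) ->
  frob (feature_dev z) ^+ 2 <= 2 * K ^+ 4.
Proof.
move=> psd.
have -> : frob (feature_dev z) ^+ 2 = norm2 (phi z) ^+ 4
    - 2 * dot (phi z) (Sig *m phi z) + frob Sig ^+ 2.
  rewrite (exprM _ 2 2) norm2_sqr dot_quadratic !frob_sqr !pair_big/=.
  rewrite (_ : dot (phi z) (phi z) ^+ 2 = \sum_(p : 'I_r * 'I_r)
      (phi z p.1 0 * phi z p.2 0) ^+ 2); last first.
    rewrite dotE expr2 mulr_suml -(pair_big xpredT xpredT
      (fun i j => (phi z i 0 * phi z j 0) ^+ 2))/=; apply: eq_bigr => i _.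
    by rewrite mulr_sumr; apply: eq_bigr => j _; ring.
  rewrite mulr_sumr -sumrN -!big_split/=; apply: eq_bigr => -[i j] _ /=.
  by rewrite 3!mxE big_ord1 !mxE; ring.
have := psd (phi z).
have : norm2 (phi z) ^+ 4 <= K ^+ 4.
  by rewrite lerXn2r ?nnegrE ?norm2_ge0 ?(ltW K_gt0).
have : frob Sig ^+ 2 <= K ^+ 4.
  rewrite (exprM K 2 2) lerXn2r ?nnegrE ?frob_ge0 ?sqr_ge0//.
  exact: frob_Sigma_pop.
by lra.
Qed.

(** Flattening turns the matrix into a family of scalar functions, as the Hoeffding inequality
    expects. *)
Definition feature_dev_coord (l : 'I_(r * r)) z : R := mxvec (feature_dev z) 0 l.

Lemma feature_dev_coordE i j z : feature_dev_coord (mxvec_index i j) z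
  = phi z i 0 * phi z j 0 - Sig i j.
Proof. by rewrite /feature_dev_coord mxvecE 3!mxE big_ord1 !mxE. Qed.

Lemma measurable_feature_dev_coord l : measurable_fun setT (feature_dev_coord l).
Proof.
case/mxvec_indexP: l => i j.
rewrite (_ : feature_dev_coord _ = (fun z => phi z i 0 * phi z j 0 - Sig i j)).
  by apply: measurable_funB => //; exact: measurable_feature_product.
by apply/funext => z; exact: feature_dev_coordE.
Qed.

Lemma Rintegral_feature_dev_coord l : Rintegral PX setT (feature_dev_coord l) = 0.
Proof.
case/mxvec_indexP: l => i j.
rewrite (_ : feature_dev_coord _ = (fun z => phi z i 0 * phi z j 0 - cst (Sig i j) z)).
  rewrite RintegralB//; last 2 first.
  - exact: feature_product_integrable.
  - exact: finite_measure_integrable_cst.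
  rewrite Rintegral_cst// [X in fine X](_ : _ = 1%E); last exact: probability_setT.
  by rewrite mulr1 !mxE subrr.
by apply/funext => z; exact: feature_dev_coordE.
Qed.

Lemma frob_empirical_dev n (z : nat -> X) : (0 < n)%N ->
  \sum_(l < r * r) (\sum_(j < n) feature_dev_coord l (z j)) ^+ 2
  = (n%:R * frob (n%:R^-1 *: (\sum_(j < n) phi (z j) *m (phi (z j))^T) - Sig)) ^+ 2.
Proof.
move=> n0; have n0' : n%:R != 0 :> R by rewrite pnatr_eq0 -lt0n.
rewrite exprMn -sum_mxvec_sqr mulr_sumr; apply: eq_bigr => l _.
rewrite -exprMn; congr (_ ^+ 2); case/mxvec_indexP: l => i j.
rewrite mxvecE; under eq_bigr do rewrite feature_dev_coordE.
rewrite sumrB sumr_const card_ord [in RHS]mxE mulrDr.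
rewrite [in RHS]mxE mulVKf// summxE; congr (_ + _).
  by apply: eq_bigr => k _; rewrite mxE big_ord1 mxE.
by rewrite [in RHS]mxE mulrN mulr_natl.
Qed.

(** By [frob_empirical_dev] this says, for n > 0 and u >= 0, that the empirical second moment is at
    Frobenius distance at least [u] from [Sig]; unnormalised sums are the form that the Hoeffding
    bound controls. *)
Definition bad_draws dO (Omega : measurableType dO) n (y : nat -> Omega -> X) (u : R)
    : set Omega :=
  [set w | (n%:R * u) ^+ 2 <=
    \sum_(l < r * r) (\sum_(j < n) feature_dev_coord l (y j w)) ^+ 2].

Lemma measurable_bad_draws dO (Omega : measurableType dO) n
    (y : nat -> Omega -> X) u :
  (forall i, measurable_fun setT (y i)) -> measurable (bad_draws n y u).
Proof.
move=> my; pose f w : R :=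
  \sum_(l < r * r) (\sum_(j < n) feature_dev_coord l (y j w)) ^+ 2.
have mf : measurable_fun setT f.
  apply: measurable_sum => l; apply: measurable_funX; apply: measurable_sum => j.
  by apply: measurableT_comp => //; exact: measurable_feature_dev_coord.
rewrite (_ : bad_draws _ _ _ = setT `&` f @^-1` `[(n%:R * u) ^+ 2, +oo[).
  exact: mf.
by rewrite setTI; apply/seteqP; split => w /=; rewrite in_itv/= andbT.
Qed.

Lemma not_bad_draws dO (Omega : measurableType dO) n (y : nat -> Omega -> X) u w :
  (0 < n)%N -> 0 <= u -> ~ bad_draws n y u w ->
  frob (n%:R^-1 *: (\sum_(j < n) phi (y j w) *m (phi (y j w))^T) - Sig) <= u.
Proof.
move=> n0 u0 /negP; rewrite -ltNge (@frob_empirical_dev n (fun j => y j w))//.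
have nR : 0 < n%:R :> R by rewrite ltr0n.
rewrite ltr_sqr ?nnegrE ?mulr_ge0 ?frob_ge0 ?ler0n//.
by rewrite ltr_pM2l// => /ltW.
Qed.

(** Hoeffding with M2 = 2 K^4 and squared radius (n u)^2: the exponent is n^2 u^2 / (8 * 2 K^4 *
    n). *)
Lemma bad_draws_le dO (Omega : measurableType dO)
    (nu : {finite_measure set Omega -> \bar R}) n (y : nat -> Omega -> X) (u : R) :
  (forall v, 0 <= dot v (Sig *m v)) ->
  (0 < n)%N -> (forall i, measurable_fun setT (y i)) ->
  (forall C : nat -> set X, (forall i, measurable (C i)) ->
    nu [set w | forall i, (i < n)%N -> C i (y i w)]
    = nu setT * \prod_(i < n) PX (C i))%E ->
  (nu (bad_draws n y u)
   <= (expR (1 / 4 - n%:R * u ^+ 2 / (16 * K ^+ 4)))%:E * nu setT)%E.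
Proof.
move=> psd n0 my ind.
have nR : n%:R != 0 :> R by rewrite pnatr_eq0 -lt0n.
have K4 : 0 < 2 * K ^+ 4 by rewrite mulr_gt0// exprn_gt0.
have bd z : \sum_(l < r * r) feature_dev_coord l z ^+ 2 <= 2 * K ^+ 4.
  by rewrite sum_mxvec_sqr; exact: frob_feature_dev.
have := hilbert_hoeffding measurable_feature_dev_coord bd
  Rintegral_feature_dev_coord K4 ((n%:R * u) ^+ 2) n0 my ind.
have -> : (n%:R * u) ^+ 2 / (8 * (2 * K ^+ 4) * n%:R) = n%:R * u ^+ 2 / (16 * K ^+ 4).
  by field; rewrite nR gt_eqF.
exact.
Qed.

End second_moment.

(** * The sampling model and concentration of both covariances *)

Lemma measure_bigsetU_le d (T : measurableType d) (R : realType)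
    (mu : {measure set T -> \bar R}) (I : Type) (s : seq I) (F : I -> set T) :
  (forall i, measurable (F i)) ->
  (mu (\big[setU/set0]_(i <- s) F i) <= \sum_(i <- s) mu (F i))%E.
Proof.
move=> mF; elim: s => [|i s IH]; first by rewrite !big_nil measure0.
have mU : measurable (\big[setU/set0]_(j <- s) F j).
  by apply: bigsetU_measurable => j _.
by rewrite !big_cons (le_trans (measureU2 mu (mF i) mU))// leeD2l.
Qed.

Section model.
Context {R : realType} {dO dX : measure_display}.
Context {Omega : measurableType dO} {X : measurableType dX}.
Variables (P : probability Omega R) (PX : probability X R) (N k : nat).
Variables (x : 'I_N -> Omega -> X) (s : Omega -> {ffun 'I_k -> 'I_N}).
Hypothesis model : iid_subsample_model P PX x s.

(** Written through a finite set because the model speaks of [s] only through such sets. *)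
Definition sample_is (f : {ffun 'I_k -> 'I_N}) : set Omega :=
  s @^-1` [set g | g \in finset (pred1 f)].

Lemma measurable_draw i : measurable_fun setT (x i).
Proof. by case: model. Qed.

Lemma measurable_sample_is f : measurable (sample_is f).
Proof. by case: model => _ + _; exact. Qed.

Lemma sample_prob (B : {set {ffun 'I_k -> 'I_N}}) :
  P [set w | s w \in B]
  = (#|B :&: inj_samples N k|%:R / #|inj_samples N k|%:R)%:E.
Proof.
case: model => _ _ /(_ (fun=> setT) B (fun=> measurableT)).
rewrite big1 => [|i _]; last by rewrite probability_setT.
by rewrite mul1e => <-; congr (P _); apply/seteqP; split => w /=; tauto.
Qed.

(** If there were no injection, the model would give the whole space a quotient by zero, which is 0
    by convention, and not 1. *)
Lemma card_inj_samples_neq0 : #|inj_samples N k|%:R != 0 :> R.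
Proof.
have := sample_prob finset.setT; rewrite (_ : [set w | _] = setT); last first.
  by apply/seteqP; split => w //= _; rewrite finset.in_setT.
rewrite probability_setT; apply: contra_eqN => /eqP ->.
by rewrite invr0 mulr0 eqe oner_eq0.
Qed.

Lemma sample_is_prob f : P (sample_is f)
  = ((f \in inj_samples N k)%:R / #|inj_samples N k|%:R)%:E.
Proof.
rewrite (sample_prob (finset (pred1 f))); congr (_%:R / _)%:E.
have -> : finset (pred1 f) = finset.set1 f.
  by apply/setP => g; rewrite !inE.
case: (boolP (f \in _)) => fi.
  by rewrite (finset.setIidPl _) ?cards1// finset.sub1set.
apply/eqP; rewrite cards_eq0; apply/eqP/setP => g; rewrite !inE.
by case: eqP => [->|//]; apply/negbTE; move: fi; rewrite inE.
Qed.

Lemma sum_sample_is_prob : (\sum_f P (sample_is f) = 1)%E.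
Proof.
under eq_bigr do rewrite sample_is_prob.
rewrite sumEFin -mulr_suml -natr_sum.
rewrite (_ : (\sum_f _)%N = #|inj_samples N k|).
  by rewrite divff ?card_inj_samples_neq0.
by rewrite -sum1_card [RHS]big_mkcond/=; apply: eq_bigr => f _; case: (f \in _).
Qed.

(** An injective [f] selects distinct points, so the product over all N points collapses to the k
    selected ones. [insubd i0] extends the indexing to [nat]; its default is never reached below
    k. *)
Lemma subsample_draws (f : {ffun 'I_k -> 'I_N}) (i0 : 'I_k) (C : nat -> set X) : injective f ->
  (forall i, measurable (C i)) ->
  P ([set w | forall i, (i < k)%N -> C i (x (f (insubd i0 i)) w)] `&` sample_is f)
  = (P (sample_is f) * \prod_(i < k) PX (C i))%E.
Proof.
move=> finj mC.
(* By injectivity this is [C i] if l = f i, and the whole space if l is not in the image of [f]. *)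
pose A l : set X := \bigcap_(i in [set i : 'I_k | f i = l]) C i.
have mA l : measurable (A l) by apply: fin_bigcap_measurable.
case: model => _ _ /(_ A (finset (pred1 f)) mA).
rewrite -sample_prob muleC => E.
transitivity (P [set w | (forall l, A l (x l w)) /\ s w \in finset (pred1 f)]).
  congr (P _); apply/seteqP; split => w /= [Cw sw]; split => //.
    by move=> l i /= <-; have := Cw i (ltn_ord i); rewrite valKd.
  by move=> i ik; have := Cw (f (insubd i0 i)) (insubd i0 i) erefl;
    rewrite val_insubd ik.
rewrite E; congr (_ * _)%E.
rewrite (bigID (fun l => l \in codom f))/= [X in (_ * X)%E]big1 ?mule1; last first.
  move=> l lf; rewrite (_ : A l = setT) ?probability_setT//.
  by apply/seteqP; split => z //= _ i /= fi; rewrite -fi codom_f in lf.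
rewrite -big_uniq/=; last first.
  by rewrite map_inj_uniq ?enum_uniq.
rewrite big_map big_enum/=; apply: eq_bigr => i _; congr (PX _).
apply/seteqP; split => z /=; first by apply.
by move=> Cz j /= /finj ->.
Qed.

Lemma full_draws (i0 : 'I_N) (C : nat -> set X) :
  (forall i, measurable (C i)) ->
  P [set w | forall i, (i < N)%N -> C i (x (insubd i0 i) w)]
  = (\prod_(i < N) PX (C i))%E.
Proof.
move=> mC; case: model => _ _ /(_ (fun i => C i) finset.setT (fun i => mC i)).
rewrite -sample_prob (_ : [set w | s w \in _] = setT); last first.
  by apply/seteqP; split => w //= _; rewrite finset.in_setT.
rewrite probability_setT mule1 => <-; congr (P _); apply/seteqP; split => w /=.
  move=> Cw; split; last by rewrite finset.in_setT.
  by move=> i; have := Cw i (ltn_ord i); rewrite valKd.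
by move=> [Cw _] i iN; have := Cw (insubd i0 i); rewrite val_insubd iN.
Qed.

Variables (r : nat) (phi : X -> 'cV[R]_r) (K : R).
Hypothesis mphi : forall i, measurable_fun setT (fun z => phi z i 0).
Hypothesis phiK : forall z, norm2 (phi z) <= K.
Hypothesis K_gt0 : 0 < K.
Hypothesis psd : forall v, 0 <= dot v (Sigma_pop PX phi *m v).

(** For each fixed [f], the bad event within s = f has mass at most eps P(s = f). These weights sum
    to 1, so the union over all [f] costs only one eps; the full sample costs the other. *)
Lemma covariance_concentration (u eps : R) : (0 < k <= N)%N -> 0 <= u ->
  expR (1 / 4 - k%:R * u ^+ 2 / (16 * K ^+ 4)) <= eps ->
  exists E : set Omega, [/\ measurable E, ((1 - 2 * eps)%:E <= P E)%E &
    forall w, E w ->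
      frob (Sigma_hatk phi (fun i => x i w) (s w) - Sigma_pop PX phi) <= u /\
      frob (Sigma_hatN phi (fun i => x i w) - Sigma_pop PX phi) <= u].
Proof.
move=> /andP[k0 kN] u0 eps_ge.
have N0 : (0 < N)%N by exact: leq_trans kN.
pose j0 : 'I_k := Ordinal k0; pose i0 : 'I_N := Ordinal N0.
have K4 : 0 < 16 * K ^+ 4 by rewrite mulr_gt0// exprn_gt0.
pose yN j := x (insubd i0 j).
pose yk (f : {ffun 'I_k -> 'I_N}) j := x (f (insubd j0 j)).
pose badN := bad_draws PX phi N yN u.
pose badk f := bad_draws PX phi k (yk f) u `&` sample_is f.
have myN j : measurable_fun setT (yN j) by exact: measurable_draw.
have myk f j : measurable_fun setT (yk f j) by exact: measurable_draw.
have mbadN : measurable badN by exact: measurable_bad_draws.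
have mbadk f : measurable (badk f).
  by apply: measurableI; [exact: measurable_bad_draws|exact: measurable_sample_is].
have mU : measurable (\big[setU/set0]_f badk f) by apply: bigsetU_measurable.
have PN : (P badN <= eps%:E)%E.
  have ind (C : nat -> set X) : (forall i, measurable (C i)) ->
      (P [set w | forall i, (i < N)%N -> C i (yN i w)]
      = P setT * \prod_(i < N) PX (C i))%E.
    by move=> mC; rewrite full_draws// probability_setT mul1e.
  apply: le_trans (bad_draws_le mphi phiK K_gt0 u psd N0 myN ind) _.
  rewrite [X in (_ * X)%E](_ : _ = 1%E); last exact: probability_setT.
  rewrite mule1 lee_fin; apply: le_trans eps_ge.
  (* As k <= N, the tail bound for N draws is below the one for k draws. *)
  rewrite ler_expR lerD2l lerN2 ler_pM2r ?invr_gt0//.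
  by rewrite ler_wpM2r ?sqr_ge0// ler_nat.
have Pk f : (P (badk f) <= eps%:E * P (sample_is f))%E.
  have PD : (P (sample_is f) < +oo)%E.
    by rewrite ltey_eq fin_num_measure//; exact: measurable_sample_is.
  have [fi|fi] := boolP (f \in inj_samples N k); last first.
    have PD0 : P (sample_is f) = 0%E by rewrite sample_is_prob (negbTE fi) mul0r.
    rewrite PD0 mule0 -PD0 le_measure ?inE//; last by move=> w [].
    exact: measurable_sample_is.
  have finj : injective f by apply/injectiveP; move: fi; rewrite inE.
  (* The unnormalised conditional law given s = f. *)
  pose nu : {finite_measure set Omega -> \bar R} := mfrestr (measurable_sample_is f) PD.
  have nuT : nu setT = P (sample_is f) by rewrite /nu/= /mfrestr/mrestr setTI.
  have ind (C : nat -> set X) : (forall i, measurable (C i)) ->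
      (nu [set w | forall i, (i < k)%N -> C i (yk f i w)]
      = nu setT * \prod_(i < k) PX (C i))%E.
    by move=> mC; rewrite nuT -(subsample_draws j0 finj mC).
  apply: le_trans (bad_draws_le mphi phiK K_gt0 u psd k0 (myk f) ind) _.
  by rewrite nuT lee_wpmul2r// lee_fin.
have eps0 : 0 <= eps by apply: le_trans eps_ge; exact: expR_ge0.
have PU : (P (\big[setU/set0]_f badk f) <= eps%:E)%E.
  apply: le_trans (measure_bigsetU_le _ _ mbadk) _.
  apply: (@le_trans _ _ (\sum_f eps%:E * P (sample_is f))%E).
    by apply: lee_sum => f _; exact: Pk.
  rewrite -ge0_sume_distrr; last by move=> f _; exact: measure_ge0.
  by rewrite sum_sample_is_prob mule1.
pose B := badN `|` \big[setU/set0]_f badk f.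
have mB : measurable B by exact: measurableU.
exists (~` B); split; first exact: measurableC.
  rewrite probability_setC// EFinB leeB//.
  apply: le_trans (measureU2 P mbadN mU) _.
  by rewrite mulr_natl mulr2n EFinD leeD.
move=> w nB; split.
  (* The random subsample is handled by the member of the union with index f = s w. *)
  have nb : ~ bad_draws PX phi k (yk (s w)) u w.
    move=> b; apply: nB; right; rewrite -bigcup_seq; exists (s w) => /=.
      by rewrite mem_index_enum.
    by split => //; rewrite /sample_is/= !inE.
  have := not_bad_draws k0 u0 nb; rewrite /Sigma_hatk.
  under eq_bigr => j _ do rewrite /yk valKd.
  exact.
have nb : ~ bad_draws PX phi N yN u w by move=> b; apply: nB; left.
have := not_bad_draws N0 u0 nb; rewrite /Sigma_hatN.
under eq_bigr => j _ do rewrite /yN valKd.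
exact.
Qed.

End model.

(** * Consequences of the hypotheses and final assembly *)

Lemma measurable_phiL d (X : measurableType d) (R : realType) r (L : 'M[R]_r)
    (phir : X -> 'cV[R]_r) i :
  (forall i, measurable_fun setT (fun z => phir z i 0)) ->
  measurable_fun setT (fun z => phiL L phir z i 0).
Proof.
move=> mphir.
rewrite (_ : (fun z => _) = fun z => \sum_j L^T i j * phir z j 0); last first.
  by apply/funext => z; rewrite mxE.
by apply: measurable_sum => j; exact: measurable_funM.
Qed.

(** In dimension 0 there is no eigenvalue, and the infimum of the empty set is 0. *)
Lemma lambda_min_gt0_dim (R : realType) r (A : 'M[R]_r) :
  0 < lambda_min A -> (0 < r)%N.
Proof.
case: r A => [|//] A; rewrite /lambda_min (_ : [set a | _] = set0) ?inf0 ?ltxx//.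
apply/seteqP; split => // a /= /eigenvalueP[v _].
by rewrite thinmx0 eqxx.
Qed.

(** If K <= 0, all features and hence [Sigma_pop] vanish; the Rayleigh bound at the all-ones vector,
    nonzero as r > 0, contradicts a positive smallest eigenvalue. *)
Lemma feature_bound_gt0 d (X : measurableType d) (R : realType)
    (PX : probability X R) r (phi : X -> 'cV[R]_r) K :
  (forall z, norm2 (phi z) <= K) -> 0 < lambda_min (Sigma_pop PX phi) -> 0 < K.
Proof.
move=> phiK lam0; rewrite ltNge; apply/negP => K0.
have phi0 z : phi z = 0.
  by apply: norm2_eq0; apply: le_anti; rewrite norm2_ge0 (le_trans (phiK z)).
have r0 := lambda_min_gt0_dim lam0; pose i0 : 'I_r := Ordinal r0.
have S0 : Sigma_pop PX phi = 0.
  apply/matrixP => i j; rewrite !mxE.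
  rewrite (_ : (fun x => _) = cst 0) ?Rintegral_cst ?mul0r//.
  by apply/funext => z; rewrite phi0 mxE mul0r.
have := lambda_min_le_rayleigh (const_mx 1) (Sigma_pop_sym PX phi).
rewrite [in dot _ _]S0 mul0mx /dot mulmx0 mxE pmulr_rle0// => h.
have /eqP : norm2 (const_mx 1 : 'cV[R]_r) ^+ 2 = 0.
  by apply: le_anti; rewrite h sqr_ge0.
rewrite sqrf_eq0 => /eqP/norm2_eq0/matrixP/(_ i0 0)/eqP.
by rewrite !mxE oner_eq0.
Qed.

Theorem theorem3p5 (R : realType) (dim r N k : nat) (sigma2 K delta : R)
  (PX : probability (dim.-tuple R) R)
  (phir : dim.-tuple R -> 'cV[R]_r) (L : 'M[R]_r)
  (dO : measure_display) (Omega : measurableType dO) (P : probability Omega R)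
  (x : 'I_N -> Omega -> dim.-tuple R) (s : Omega -> {ffun 'I_k -> 'I_N}) :
  0 < sigma2 ->
  (forall i : 'I_r, measurable_fun setT (fun z => phir z i 0)) ->
  (forall z, norm2 (phiL L phir z) <= K) ->
  0 < lambda_min (Sigma_pop PX (phiL L phir)) ->
  0 < delta ->
  (k <= N)%N ->
  8 / 3 * ln (4 * r%:R / delta)
    * (8 * K ^+ 2 / lambda_min (Sigma_pop PX (phiL L phir))) ^+ 2 <= k%:R ->
  iid_subsample_model P PX x s ->
  exists E : set Omega, measurable E /\ ((1 - delta)%:E <= P E)%E /\
    forall w, E w ->
      forall (N' : nat) (xs' : 'I_N' -> dim.-tuple R),
        spec_norm
          (S_post (phiL L phir) sigma2 N
             (Sigma_hatk (phiL L phir) (fun i => x i w) (s w)) xs'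
           - S_post (phiL L phir) sigma2 N
             (Sigma_hatN (phiL L phir) (fun i => x i w)) xs')
        <= N'%:R * (2 * K ^+ 4 / lambda_min (Sigma_pop PX (phiL L phir)))
           * Num.sqrt (8 * ln (4 * r%:R / delta) / (3 * k%:R)).
Proof.
move=> sig0 mphir phiK lam0 delta0 kN k_ge model.
set phi := phiL L phir in phiK lam0 k_ge *.
set S := Sigma_pop PX phi in lam0 k_ge *.
set lam := lambda_min S in lam0 k_ge *.
(* For delta >= 1 the empty event will do; otherwise 4 r / delta > 1 and the logarithm is
   positive. *)
have [delta1|delta1] := leP 1 delta.
  by exists set0; split => //; split => //; rewrite measure0 lee_fin subr_le0.
have mphi i : measurable_fun setT (fun z => phi z i 0) by exact: measurable_phiL.
have r0 : (0 < r)%N by exact: lambda_min_gt0_dim lam0.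
have K0 : 0 < K by exact: feature_bound_gt0 phiK lam0.
have rayleigh v : lam * norm2 v ^+ 2 <= dot v (S *m v).
  by apply: lambda_min_le_rayleigh; exact: Sigma_pop_sym.
have psd v : 0 <= dot v (S *m v).
  by apply: le_trans (rayleigh v); rewrite mulr_ge0 ?sqr_ge0 ?ltW.
have r1 : 1 <= r%:R :> R by rewrite ler1n.
have q0 : 0 < 4 * r%:R / delta by rewrite divr_gt0 ?mulr_gt0 ?ltr0n.
set ell := ln (4 * r%:R / delta) in k_ge *.
have ell0 : 0 < ell by rewrite ln_gt0// ltr_pdivlMr//; lra.
have kR : 0 < k%:R :> R.
  have c0 : 0 < 8 * K ^+ 2 / lam by rewrite divr_gt0// mulr_gt0// exprn_gt0.
  apply: lt_le_trans k_ge; apply: mulr_gt0; last exact: exprn_gt0.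
  by rewrite mulr_gt0// divr_gt0.
have k0 : (0 < k)%N by rewrite -(ltr0n R).
have N0 : (0 < N)%N by exact: leq_trans kN.
set t := Num.sqrt _.
have t0 : 0 <= t by exact: sqrtr_ge0.
have tE : t ^+ 2 = 8 * ell / (3 * k%:R).
  by rewrite sqr_sqrtr// divr_ge0 ?mulr_ge0 ?ltW.
(* This choice makes K^2 * 3 u / (4 lam) equal to 2 K^4 t / lam, the claimed rate. *)
pose u := 8 / 3 * K ^+ 2 * t.
have u0 : 0 <= u.
  by apply: mulr_ge0 => //; apply: mulr_ge0; [exact: divr_ge0|exact: sqr_ge0].
(* After squaring, 8 K^2 t <= lam is exactly the lower bound on k. *)
have ulam : 3 * u <= lam.
  have -> : 3 * u = 8 * K ^+ 2 * t by rewrite /u; field.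
  have Kt0 : 0 <= 8 * K ^+ 2 * t.
    by apply: mulr_ge0 => //; apply: mulr_ge0; [|exact: sqr_ge0].
  rewrite -ler_sqr ?nnegrE ?(ltW lam0)//.
  rewrite exprMn tE.
  rewrite [leLHS](_ : _ = 8 / 3 * ell * (8 * K ^+ 2 / lam) ^+ 2 / k%:R * lam ^+ 2).
    by rewrite ler_piMl ?sqr_ge0// ler_pdivrMr// mul1r.
  by field; rewrite !gt_eqF.
(* The exponent is 1/4 - (32/27) ell <= 1/4 - ell. Since exp (1/4) <= 2, the tail is at most 2 delta
   / (4 r) <= delta / 2. *)
have tail : expR (1 / 4 - k%:R * u ^+ 2 / (16 * K ^+ 4)) <= delta / 2.
  have -> : k%:R * u ^+ 2 / (16 * K ^+ 4) = 32 / 27 * ell.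
    by rewrite /u !exprMn tE; field; rewrite !gt_eqF.
  apply: (@le_trans _ _ (expR (1 / 4 - ell))).
    by rewrite ler_expR lerD2l lerN2; lra.
  rewrite expRB [expR ell]lnK ?posrE// invf_div.
  have e4 : expR (1 / 4) <= 2 :> R.
    have := expR_ge1Dx (- (1 / 4) : R); have := expRxMexpNx_1 (1 / 4 : R).
    by have := expR_gt0 (1 / 4 : R); nra.
  have h : delta / (4 * r%:R) <= delta / 4.
    rewrite ler_pM2l// lef_pV2 ?posrE ?mulr_gt0//; lra.
  apply: (@le_trans _ _ (2 * (delta / 4))); last by lra.
  apply: ler_pM => //.
  by apply: divr_ge0; [exact: ltW|apply: mulr_ge0].
have k0N : (0 < k <= N)%N by rewrite k0.
have [E [mE PE goodE]] :=
  covariance_concentration model mphi phiK K0 psd k0N u0 tail.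
exists E; split => //; split.
  by apply: le_trans PE; rewrite lee_fin; lra.
move=> w /goodE[Sk SN] N' xs'.
have -> : N'%:R * (2 * K ^+ 4 / lam) * t = N'%:R * K ^+ 2 * (3 * u / (4 * lam)).
  by rewrite /u; field; rewrite gt_eqF.
exact: (spec_norm_S_post_diff (S := S)).
Qed.
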